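(* Let $\mathbf{E}_J$ be a $W$-graph ideal with respect to $J\subseteq S$ and $L$, with associated $\mathcal H$-module $M=M(\mathbf{E}_J,L)$, basis $\{\Gamma_w\mid w\in\mathbf{E}_J\}$, polynomials $r^s_{z,w}$ and involution $\alpha\mapsto\overline{\alpha}$. (I) The following hold. (i) There exists an $A$-free $\mathcal H$-module $\widetilde M=\widetilde M(\mathbf{E}_J,L)$ possessing an $A$-basis $\{\widetilde\Gamma_w\mid w\in\mathbf{E}_J\}$ such that for all $s\in S$ and $w\in\mathbf{E}_J$ $$T_s\widetilde\Gamma_w=\begin{cases}\widetilde\Gamma_{sw}+(q^{L(s)}-q^{-L(s)})\widetilde\Gamma_w & \text{if } w\in\mathbf{E}_{J,s}^-,\\ \widetilde\Gamma_{sw} & \text{if } w\in\mathbf{E}_{J,s}^+,\\ q^{L(s)}\widetilde\Gamma_w & \text{if } w\in\mathbf{E}_{J,s}^{0,-},\\ -q^{-L(s)}\widetilde\Gamma_w+\sum_{z\in\mathbf{E}_J,\,z<w}\widetilde r^{\,s}_{z,w}\widetilde\Gamma_z & \text{if } w\in\mathbf{E}_{J,s}^{0,+},\end{cases}$$ where $\widetilde r^{\,s}_{z,w}=\epsilon_z\epsilon_w\overline{r^s_{z,w}}\in q^{-L(s)}A_{<0}$. (ii) $\widetilde M$ admits an $A$-semilinear involution $\widetilde\alpha\mapsto\overline{\widetilde\alpha}$ satisfying $\overline{\widetilde\Gamma_1}=\widetilde\Gamma_1$ and $\overline{h\widetilde\alpha}=\overline h\,\overline{\widetilde\alpha}$ for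 all $h\in\mathcal H$, $\widetilde\alpha\in\widetilde M$. (II) There exists a unique map $\eta:M\to\widetilde M$ such that (i) $\eta(\Gamma_1)=\widetilde\Gamma_1$ and (ii) $\eta(h m)=\Phi(h)\eta(m)$ for all $h\in\mathcal H$ and $m\in M$. Further: (a) $\eta$ commutes with the involutions on $M$ and $\widetilde M$, i.e. $\eta(\overline m)=\overline{\eta(m)}$ for all $m\in M$; (b) $\eta$ is a bijection, and its inverse $\theta:\widetilde M\to M$ satisfies the analogous properties: $\theta(\widetilde\Gamma_1)=\Gamma_1$ and $\theta(h\widetilde m)=\Phi(h)\theta(\widetilde m)$ for all $h\in\mathcal H$, $\widetilde m\in\widetilde M$.
   Context: Let $(W,S)$ be a Coxeter system with length function $\ell$ and Bruhat order $\leqslant$; put $\epsilon_w=(-1)^{\ell(w)}$. Let $\Gamma$ be a totally ordered abelian group (written additively) and $L:W\to\Gamma$ a weight function: elements $L(s)\in\Gamma$ ($s\in S$) are given with $L(s)=L(t)$ whenever $s,t$ are conjugate in $W$, and $L(w)=L(s_1)+\dots+L(s_k)$ for a reduced expression $w=s_1\cdots s_k$. Assume $L(s)\geqslant 0$ for all $s\in S$. Let $R\subseteq\mathbb C$ be a subring and $A=R[\Gamma]$ the group algebra, with $R$-basis $\{q^\gamma\mid\gamma\in\Gamma\}$, $q^\gamma q^{\gamma'}=q^{\gamma+\gamma'}$. $A_{>0}$ (resp. $A_{<0}$) is the set of $R$-linear combinations of $q^\gamma$ with $\gamma>0$ (resp. $\gamma<0$). The ring involution $a\mapsto\overline a$ of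 $A$ is the $R$-linear map with $\overline{q^\gamma}=q^{-\gamma}$. $\mathcal H$ is the Hecke algebra over $A$ with basis $\{T_w\mid w\in W\}$ and $T_sT_w=T_{sw}$ if $\ell(sw)>\ell(w)$, $T_sT_w=T_{sw}+(q^{L(s)}-q^{-L(s)})T_w$ if $\ell(sw)<\ell(w)$. It has the ring involution $\overline{\sum a_wT_w}=\sum\overline{a_w}\,T_{w^{-1}}^{-1}$. $\Phi:\mathcal H\to\mathcal H$ is the $A$-algebra homomorphism with $\Phi(T_w)=\epsilon_w\overline{T_w}$; one has $\Phi^2=\mathrm{Id}$ and $\Phi$ commutes with the bar involution. For $J\subseteq S$ let $D_J=\{w\in W\mid\ell(ws)>\ell(w)\text{ for all }s\in J\}$. The left weak order: $x\leqslant_L y$ iff $y=zx$ with $\ell(y)=\ell(z)+\ell(x)$. Let $\mathbf{E}=\mathbf{E}_J$ be an ideal of $(W,\leqslant_L)$ (if $y\in\mathbf{E}$ and $x\leqslant_L y$ then $x\in\mathbf{E}$) containing $1$ and with $\mathbf{E}_J\subseteq D_J$. For $s\in S$ put $\mathbf{E}_{J,s}^-=\{w\in\mathbf{E}_J\mid\ell(sw)<\ell(w),\ sw\in\mathbf{E}_J\}$, $\mathbf{E}_{J,s}^+=\{w\in\mathbf{E}_J\mid\ell(sw)>\ell(w),\ sw\in\mathbf{E}_J\}$, $\mathbf{E}_{J,s}^{0,-}=\{w\in\mathbf{E}_J\mid\ell(sw)>\ell(w),\ sw\notin D_J\}$, $\mathbf{E}_{J,s}^{0,+}=\{w\in\mathbf{E}_J\mid\ell(sw)>\ell(w),\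 sw\in D_J\setminus\mathbf{E}_J\}$. $\mathbf{E}_J$ is a $W$-graph ideal with respect to $J$ and $L$ if: (i) there is an $A$-free $\mathcal H$-module $M(\mathbf{E}_J,L)$ with $A$-basis $\{\Gamma_w\mid w\in\mathbf{E}_J\}$ such that for all $s\in S$, $w\in\mathbf{E}_J$: $T_s\Gamma_w=\Gamma_{sw}+(q^{L(s)}-q^{-L(s)})\Gamma_w$ if $w\in\mathbf{E}_{J,s}^-$; $T_s\Gamma_w=\Gamma_{sw}$ if $w\in\mathbf{E}_{J,s}^+$; $T_s\Gamma_w=-q^{-L(s)}\Gamma_w$ if $w\in\mathbf{E}_{J,s}^{0,-}$; $T_s\Gamma_w=q^{L(s)}\Gamma_w-\sum_{z\in\mathbf{E}_J,\,z<w}r^s_{z,w}\Gamma_z$ if $w\in\mathbf{E}_{J,s}^{0,+}$, for some $r^s_{z,w}\in q^{L(s)}A_{>0}$; (ii) $M(\mathbf{E}_J,L)$ admits an $A$-semilinear involution $\alpha\mapsto\overline\alpha$ with $\overline{\Gamma_1}=\Gamma_1$ and $\overline{h\alpha}=\overline h\,\overline\alpha$ for all $h\in\mathcal H$, $\alpha\in M(\mathbf{E}_J,L)$. ($A$-semilinear means additive with $\overline{a\alpha}=\overline a\,\overline\alpha$ for $a\in A$.) *)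

(* Defs.v *)
From HB Require Import structures.
From Stdlib Require Import Relation_Operators.
From mathcomp Require Import all_boot all_order all_algebra finmap.
From mathcomp Require Import boolp classical_sets fsbigop.
From mathcomp.multinomials Require Import monalg.

Set Implicit Arguments.
Unset Strict Implicit.
Unset Printing Implicit Defensive.

Import Order.TTheory GRing.Theory Num.Theory.

Local Open Scope fset_scope.
Local Open Scope ring_scope.

Record ordered_group (G : porderZmodType) : Prop := OrderedGroup {
  og_total : forall x y : G, (x <= y) || (y <= x);
  og_add : forall x y z : G, x <= y -> x + z <= y + z }.

(* The ring structure that monalg puts on {malg R[K]} requires a monoid K of
   monomials without nontrivial invertible elements, which excludes groups;
   the convolution product is therefore defined here, on the same R-module. *)
Section GroupAlgebra.
Variables (R : comNzRingType) (G : zmodType).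

Definition grpalg : Type := {malg R[G]}.

HB.instance Definition _ := GRing.Lmodule.copy grpalg {malg R[G]}.

Implicit Types (a b c : grpalg) (g : G).

Definition qpow g : grpalg := << 1 *g g >>.

Definition ga_mul a b : grpalg :=
  \sum_(x <- msupp a) \sum_(y <- msupp b) << a@_x * b@_y *g x + y >>.

Lemma ga_mulw (d1 d2 : {fset G}) a b :
  msupp a `<=` d1 -> msupp b `<=` d2 ->
  ga_mul a b = \sum_(x <- d1) \sum_(y <- d2) << a@_x * b@_y *g x + y >>.
Proof.
move=> le_d1 le_d2; rewrite /ga_mul (big_fset_incl _ le_d1) /=.
  apply/eq_bigr=> x _; apply/big_fset_incl => // k _ /mcoeff_outdom ->.
  by rewrite mulr0 monalgU0.
move=> k _ /mcoeff_outdom ak.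
by rewrite big1 // => k' _; rewrite ak mul0r monalgU0.
Qed.

Lemma ga_mulUU (x y : R) (g h : G) :
  ga_mul << x *g g >> << y *g h >> = << x * y *g g + h >>.
Proof. by rewrite (ga_mulw msuppU_le msuppU_le) !big_seq_fset1 !mcoeffUU. Qed.

Lemma ga_mulC : commutative ga_mul.
Proof.
move=> a b; rewrite /ga_mul exchange_big /=; apply: eq_bigr => y _.
by apply: eq_bigr => x _; rewrite mulrC addrC.
Qed.

Lemma ga_mul0 : left_zero (0 : grpalg) ga_mul.
Proof. by move=> a; rewrite /ga_mul msupp0 big_seq_fset0. Qed.

Lemma ga_mulDl : left_distributive ga_mul +%R.
Proof.
move=> a b c.
rewrite [X in _ = X + _](ga_mulw (fsubsetUl _ (msupp b)) (fsubset_refl _)).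
rewrite [X in _ = _ + X](ga_mulw (fsubsetUr (msupp a) _) (fsubset_refl _)).
rewrite (ga_mulw (msuppD_le _ _) (fsubset_refl _)) -big_split /=.
apply/eq_bigr=> x _; rewrite -big_split /=; apply/eq_bigr=> y _.
by rewrite mcoeffD mulrDl monalgUD.
Qed.

Lemma ga_mulDr : right_distributive ga_mul +%R.
Proof. by move=> a b c; rewrite !(ga_mulC a) ga_mulDl. Qed.

Lemma ga_mul1 : left_id (qpow 0) ga_mul.
Proof.
move=> a; rewrite (ga_mulw msuppU_le (fsubset_refl _)) big_seq_fset1.
rewrite [RHS]monalgE; apply/eq_bigr=> x _.
by rewrite mcoeffUU mul1r add0r.
Qed.

Lemma ga_mul_suml I (s : seq I) (F : I -> grpalg) b :
  ga_mul (\sum_(i <- s) F i) b = \sum_(i <- s) ga_mul (F i) b.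
Proof. exact: (big_morph (ga_mul^~ b) (fun x y => ga_mulDl x y b) (ga_mul0 b)). Qed.

Lemma ga_mul_sumr I (s : seq I) (F : I -> grpalg) b :
  ga_mul b (\sum_(i <- s) F i) = \sum_(i <- s) ga_mul b (F i).
Proof.
by rewrite ga_mulC ga_mul_suml; apply: eq_bigr => i _; rewrite ga_mulC.
Qed.

Lemma ga_mulA : associative ga_mul.
Proof.
have mulA_UUU x y z (g h k : G) :
    ga_mul << x *g g >> (ga_mul << y *g h >> << z *g k >>) =
    ga_mul (ga_mul << x *g g >> << y *g h >>) << z *g k >>.
  by rewrite !ga_mulUU mulrA addrA.
have mulA_UU x y (g h : G) c :
    ga_mul << x *g g >> (ga_mul << y *g h >> c) =
    ga_mul (ga_mul << x *g g >> << y *g h >>) c.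
  rewrite [c]monalgE (ga_mul_sumr _ _ << y *g h >>).
  rewrite (ga_mul_sumr _ _ << x *g g >>) (ga_mul_sumr _ _ (ga_mul _ _)).
  by apply: eq_bigr => z _; apply: mulA_UUU.
have mulA_U x (g : G) b c :
    ga_mul << x *g g >> (ga_mul b c) = ga_mul (ga_mul << x *g g >> b) c.
  rewrite [b]monalgE (ga_mul_suml _ _ c) !(ga_mul_sumr _ _ << x *g g >>).
  by rewrite (ga_mul_suml _ _ c); apply: eq_bigr => y _; apply: mulA_UU.
move=> a b c; rewrite [a]monalgE (ga_mul_suml _ _ (ga_mul b c)).
rewrite (ga_mul_suml _ _ b) (ga_mul_suml _ _ c).
by apply: eq_bigr => x _; apply: mulA_U.
Qed.

Lemma ga_one_neq0 : qpow 0 != 0.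
Proof. by rewrite /qpow monalgU_eq0 oner_eq0. Qed.

HB.instance Definition _ := GRing.Zmodule_isComNzRing.Build grpalg
  ga_mulA ga_mulC ga_mul1 ga_mulDl ga_one_neq0.

Lemma ga_scaleU (x y : R) g : x *: (<< y *g g >> : grpalg) = << x * y *g g >>.
Proof. by apply/malgP=> k; rewrite mcoeffZ !mcoeffU mulrnAr. Qed.

Lemma ga_scaleAl (x : R) a b : x *: (a * b) = (x *: a) * b.
Proof.
have -> : (x *: a) * b = _ := ga_mulw (msuppZ_le x a) (fsubset_refl _).
have -> : a * b = _ := ga_mulw (fsubset_refl _) (fsubset_refl _).
rewrite scaler_sumr.
apply: eq_bigr => y _; rewrite scaler_sumr; apply: eq_bigr => z _.
by rewrite mcoeffZ ga_scaleU mulrA.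
Qed.

HB.instance Definition _ :=
  GRing.Lmodule_isLalgebra.Build R grpalg ga_scaleAl.
HB.instance Definition _ := GRing.Lalgebra_isComAlgebra.Build R grpalg.

Lemma qpowD g h : qpow (g + h) = qpow g * qpow h.
Proof. by rewrite [RHS]ga_mulUU mulr1. Qed.

Lemma qpow0 : qpow 0 = 1.
Proof. by []. Qed.

Lemma grpalgE a : a = \sum_(g <- msupp a) a@_g *: qpow g.
Proof.
by rewrite {1}[a]monalgE; apply: eq_bigr => g _; rewrite ga_scaleU mulr1.
Qed.

Definition ga_bar a : grpalg := \sum_(g <- msupp a) a@_g *: qpow (- g).

Lemma ga_barw (d : {fset G}) a : msupp a `<=` d ->
  ga_bar a = \sum_(g <- d) a@_g *: qpow (- g).
Proof.
move=> le_d; rewrite /ga_bar (big_fset_incl _ le_d) //= => g _ /mcoeff_outdom ->.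
by rewrite scale0r.
Qed.

Lemma ga_bar_qpow g : ga_bar (qpow g) = qpow (- g).
Proof. by rewrite (ga_barw msuppU_le) big_seq_fset1 mcoeffUU scale1r. Qed.

Lemma ga_bar_linear (x : R) a b :
  ga_bar (x *: a + b) = x *: ga_bar a + ga_bar b.
Proof.
have sa : msupp (x *: a + b) `<=` msupp a `|` msupp b.
  by rewrite (fsubset_trans (msuppD_le _ _)) // fsetSU // msuppZ_le.
rewrite (ga_barw sa) (ga_barw (fsubsetUl (msupp a) (msupp b))).
rewrite (ga_barw (fsubsetUr (msupp a) (msupp b))) scaler_sumr -big_split /=.
by apply: eq_bigr => g _; rewrite mcoeffD mcoeffZ scalerDl scalerA.
Qed.

End GroupAlgebra.

Section PositivePart.
Variables (R : comNzRingType) (G : porderZmodType).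

Definition ga_pos (a : grpalg R G) := forall g, g \in msupp a -> 0 < g.
Definition ga_neg (a : grpalg R G) := forall g, g \in msupp a -> g < 0.

End PositivePart.

Section Coxeter.
Variables (W : groupType) (S : set W).

Definition word_in (u : seq W) := forall s, s \in u -> S s.

Definition wprod (u : seq W) : W := (\prod_(s <- u) s)%g.

(* Congruence on words generated by the relations (st)^m(s,t) = 1; the value
   m(s,t) = 0 stands for infinity (no relation). Since m(s,s) = 1 makes every
   generator its own inverse, the words modulo this congruence form the group
   presented by these relations. *)
Inductive cox_eqv (m : W -> W -> nat) : seq W -> seq W -> Prop :=
| cox_eqv_rel u v s t of S s & S t :
    cox_eqv m (u ++ flatten (nseq (m s t) [:: s; t]) ++ v) (u ++ v)
| cox_eqv_refl u : cox_eqv m u u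
| cox_eqv_sym u v of cox_eqv m u v : cox_eqv m v u
| cox_eqv_trans u v w of cox_eqv m u v & cox_eqv m v w : cox_eqv m u w.

Definition coxeter_matrix (m : W -> W -> nat) :=
  [/\ forall s, S s -> m s s = 1%N,
      forall s t, S s -> S t -> m s t = m t s
    & forall s t, S s -> S t -> s <> t -> m s t <> 1%N].

Definition coxeter_system :=
  exists m : W -> W -> nat,
    [/\ coxeter_matrix m,
        forall w : W, exists2 u, word_in u & wprod u = w
      & forall u v, word_in u -> word_in v ->
          (wprod u = wprod v <-> cox_eqv m u v)].

Definition has_word (w : W) (n : nat) :=
  exists u, [/\ word_in u, wprod u = w & size u = n].

(* The default value 0 is only used if S does not generate W. *)
Definition len (w : W) : nat :=
  match pselect (exists n, `[< has_word w n >]) with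
  | left ex_n => ex_minn ex_n
  | right _ => 0%N
  end.

Definition reduced (u : seq W) := word_in u /\ size u = len (wprod u).

Definition reflection (t : W) := exists w s, S s /\ t = (w * s * w^-1)%g.

Definition bruhat_step (x y : W) :=
  exists t, [/\ reflection t, y = (t * x)%g & (len x < len y)%N].

Definition bruhat_le : W -> W -> Prop := clos_refl_trans W bruhat_step.

Definition bruhat_lt (x y : W) := bruhat_le x y /\ x <> y.

Definition left_weak_le (x y : W) :=
  exists z, y = (z * x)%g /\ len y = (len z + len x)%N.

Definition left_weak_ideal (E : set W) :=
  forall x y, E y -> left_weak_le x y -> E x.

Definition D (J : set W) : set W :=
  [set w | forall s, J s -> (len w < len (w * s)%g)%N].

Definition weight_function (G : zmodType) (L : W -> G) :=
  (forall s t, S s -> S t -> (exists w, t = (w * s * w^-1)%g) -> L s = L t) /\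
  (forall u, reduced u -> L (wprod u) = \sum_(s <- u) L s).

Section Parts.
Variables (J E : set W) (s : W).

Definition E_minus : set W :=
  [set w | [/\ E w, (len (s * w)%g < len w)%N & E (s * w)%g]].
Definition E_plus : set W :=
  [set w | [/\ E w, (len w < len (s * w)%g)%N & E (s * w)%g]].
Definition E_0minus : set W :=
  [set w | [/\ E w, (len w < len (s * w)%g)%N & ~ D J (s * w)%g]].
Definition E_0plus : set W :=
  [set w | [/\ E w, (len w < len (s * w)%g)%N, D J (s * w)%g
             & ~ E (s * w)%g]].

End Parts.
End Coxeter.

(* (b i)_{i in E} is a basis of M over A, acting through sc; the values of b
   outside E are irrelevant. *)
Definition is_basis (A : nzRingType) (M : zmodType) (sc : A -> M -> M)
    (I : eqType) (E : set I) (b : I -> M) :=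
  (forall x : M, exists (u : seq I) (c : I -> A),
     (forall i, i \in u -> E i) /\ x = \sum_(i <- u) sc (c i) (b i)) /\
  (forall (u : seq I) (c : I -> A), uniq u -> (forall i, i \in u -> E i) ->
     \sum_(i <- u) sc (c i) (b i) = 0 -> forall i, i \in u -> c i = 0).

Section Hecke.
Variables (R : comNzRingType) (G : porderZmodType).
Variables (W : groupType) (S : set W) (L : W -> G).

Local Notation A := (grpalg R G).
Local Notation q := (@qpow R G).
Local Notation len := (len S).

Definition eps (w : W) : A := (-1) ^+ len w.

(* T 1 = 1 is not listed: the two rules give h * T 1 = h for every h. *)
Record hecke_algebra (H : algType A) (T : W -> H) : Prop := HeckeAlgebra {
  hecke_basis : is_basis *:%R [set: W]%classic T;
  hecke_up : forall s w, S s -> (len w < len (s * w)%g)%N ->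
    T s * T w = T (s * w)%g;
  hecke_down : forall s w, S s -> (len (s * w)%g < len w)%N ->
    T s * T w = T (s * w)%g + (q (L s) - q (- L s)) *: T w }.

(* bar (T w) is the inverse of T (w^-1). *)
Record hecke_bar (H : algType A) (T : W -> H) (bar : H -> H) : Prop :=
  HeckeBar {
  hecke_bar_add : forall h k, bar (h + k) = bar h + bar k;
  hecke_bar_scale : forall (a : A) h, bar (a *: h) = ga_bar a *: bar h;
  hecke_bar_T : forall w,
    bar (T w) * T (w^-1)%g = 1 /\ T (w^-1)%g * bar (T w) = 1 }.

Definition hecke_Phi (H : algType A) (T : W -> H) (bar : H -> H)
    (Phi : {lrmorphism H -> H}) :=
  forall w, Phi (T w) = eps w *: bar (T w).

(* An H-module is an A-module through a |-> a%:A. *)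
Definition ascale (H : algType A) (M : lmodType H) (a : A) (x : M) : M :=
  (a%:A : H) *: x.

Record semilinear_involution (H : algType A) (bar : H -> H) (M : lmodType H)
    (x1 : M) (barM : M -> M) : Prop := SemilinearInvolution {
  si_add : forall x y, barM (x + y) = barM x + barM y;
  si_scale : forall (a : A) x, barM (ascale a x) = ascale (ga_bar a) (barM x);
  si_invol : forall x, barM (barM x) = x;
  si_base : barM x1 = x1;
  si_hecke : forall (h : H) x, barM (h *: x) = bar h *: barM x }.

Record wgraph_ideal_set (J E : set W) : Prop := WgraphIdealSet {
  wi_sub : forall s, J s -> S s;
  wi_ideal : left_weak_ideal S E;
  wi_one : E 1%g;
  wi_D : forall w, E w -> D S J w }.

(* The sums over {z in E | z < w} are over a finite set, lower Bruhat
   intervals being finite. *)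
Record wgraph_module (J E : set W) (H : algType A) (T : W -> H)
    (bar : H -> H) (M : lmodType H) (Gam : W -> M) (r : W -> W -> W -> A)
    (barM : M -> M) : Prop := WgraphModule {
  wm_basis : is_basis (@ascale H M) E Gam;
  wm_minus : forall s w, S s -> E_minus S E s w ->
    T s *: Gam w = Gam (s * w)%g + ascale (q (L s) - q (- L s)) (Gam w);
  wm_plus : forall s w, S s -> E_plus S E s w ->
    T s *: Gam w = Gam (s * w)%g;
  wm_0minus : forall s w, S s -> E_0minus S J E s w ->
    T s *: Gam w = ascale (- q (- L s)) (Gam w);
  wm_0plus : forall s w, S s -> E_0plus S J E s w ->
    T s *: Gam w = ascale (q (L s)) (Gam w)
      - \sum_(z \in [set z | E z /\ bruhat_lt S z w]%classic)
          ascale (r s z w) (Gam z);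
  wm_r : forall s z w, S s -> E_0plus S J E s w -> E z -> bruhat_lt S z w ->
    exists2 a : A, ga_pos a & r s z w = q (L s) * a;
  wm_bar : semilinear_involution bar (Gam 1%g) barM }.

Definition r_dual (r : W -> W -> W -> A) (s z w : W) : A :=
  eps z * eps w * ga_bar (r s z w).

Record wgraph_dual_module (J E : set W) (H : algType A) (T : W -> H)
    (bar : H -> H) (M : lmodType H) (Gam : W -> M) (r : W -> W -> W -> A)
    (barM : M -> M) : Prop := WgraphDualModule {
  wd_basis : is_basis (@ascale H M) E Gam;
  wd_minus : forall s w, S s -> E_minus S E s w ->
    T s *: Gam w = Gam (s * w)%g + ascale (q (L s) - q (- L s)) (Gam w);
  wd_plus : forall s w, S s -> E_plus S E s w ->
    T s *: Gam w = Gam (s * w)%g;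
  wd_0minus : forall s w, S s -> E_0minus S J E s w ->
    T s *: Gam w = ascale (q (L s)) (Gam w);
  wd_0plus : forall s w, S s -> E_0plus S J E s w ->
    T s *: Gam w = ascale (- q (- L s)) (Gam w)
      + \sum_(z \in [set z | E z /\ bruhat_lt S z w]%classic)
          ascale (r s z w) (Gam z);
  wd_r : forall s z w, S s -> E_0plus S J E s w -> E z -> bruhat_lt S z w ->
    exists2 a : A, ga_neg a & r s z w = q (- L s) * a;
  wd_bar : semilinear_involution bar (Gam 1%g) barM }.

Definition twisted_morphism (H : algType A) (Phi : H -> H)
    (M N : lmodType H) (x1 : M) (y1 : N) (f : M -> N) :=
  f x1 = y1 /\ forall (h : H) x, f (h *: x) = Phi h *: f x.

End Hecke.

(* Main.v *)
Require Import Defs.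
From HB Require Import structures.
From mathcomp Require Import all_boot all_order all_algebra finmap.
From mathcomp Require Import boolp classical_sets fsbigop reals.
From mathcomp.real_closed Require Import complex.
From mathcomp.multinomials Require Import monalg.

(** The dual module is [M] itself with the action twisted by [Phi]: let [h] act
    as [Phi h] did, keep the involution of [M], and take as new basis the
    elements [eps_w * bar (Gamma_w)]. As [Phi (T_s) = - bar (T_s)], applying the
    semilinear involution of [M] to the formula for [T_s Gamma_w] and changing
    signs gives exactly the formula required of the dual basis
    ([twist_dual_module]). The involution of [M] is still compatible with the
    twisted action because [Phi] and [bar] commute on [M]: on the [T_w] this
    follows from [Phi (bar (T_w)) = eps_w T_w] ([Phi_barT]) and from
    [bar (bar h)] acting on [M] as [h] does ([si_barK]).

    The rules for the [T_s] determine a dual module up to a unique isomorphism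
    preserving the base vector: the linear map that matches the two bases
    commutes with every [T_s], hence with the Hecke algebra
    ([dual_module_iso]). So any dual module [M'] is isomorphic to the twist of
    [M], and the isomorphism, read as a map from [M] to [M'], is [eta]; it is
    [Phi]-semilinear since [Phi] is an involution ([PhiK]). Everything else
    follows from the fact that the base vector generates the module
    ([dual_module_cyclic]): uniqueness of [eta], and its compatibility with the
    involutions.

    The signs behave as required because the defining relations of a Coxeter
    group have even length: left multiplication by a generator changes the
    length by exactly one, hence changes [eps]. *)

Set Implicit Arguments.
Unset Strict Implicit.
Unset Printing Implicit Defensive.

Import GRing.Theory.
Local Open Scope ring_scope.

(** * The bar involution of the group algebra *)

Section GroupAlgebraBar.
Variables (R : comNzRingType) (G : zmodType).
Implicit Types a b : grpalg R G.

Lemma ga_barD a b : ga_bar (a + b) = ga_bar a + ga_bar b.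
Proof. by have := ga_bar_linear 1 a b; rewrite !scale1r. Qed.

Lemma ga_bar0 : ga_bar (0 : grpalg R G) = 0.
Proof. by apply: (addrI (ga_bar 0)); rewrite -ga_barD !addr0. Qed.

Lemma ga_barN a : ga_bar (- a) = - ga_bar a.
Proof. by apply: (addrI (ga_bar a)); rewrite -ga_barD !subrr ga_bar0. Qed.

Lemma ga_barZ (x : R) a : ga_bar (x *: a) = x *: ga_bar a.
Proof. by have := ga_bar_linear x a 0; rewrite ga_bar0 !addr0. Qed.

Lemma mcoeff_ga_bar a g : (ga_bar a)@_g = a@_(- g).
Proof.
rewrite /ga_bar raddf_sum /=.
under eq_bigr => h _ do rewrite mcoeffZ mcoeffU eqr_oppLR.
have [supp_g|/mcoeff_outdom a_g] := boolP (- g \in msupp a); last first.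
  rewrite a_g big_seq big1 // => h supp_h.
  by have [eq_h|_] := eqVneq h (- g); rewrite ?mulr0 // eq_h a_g mul0r.
rewrite (bigD1_seq (- g)) ?fset_uniq //= eqxx mulr1.
by rewrite big1 ?addr0 // => h /negbTE->; rewrite mulr0.
Qed.

Lemma ga_barK a : ga_bar (ga_bar a) = a.
Proof. by apply/malgP => g; rewrite !mcoeff_ga_bar opprK. Qed.

Lemma ga_bar_sum I (u : seq I) (F : I -> grpalg R G) :
  ga_bar (\sum_(i <- u) F i) = \sum_(i <- u) ga_bar (F i).
Proof. exact: (big_morph _ ga_barD ga_bar0). Qed.

Lemma ga_barM a b : ga_bar (a * b) = ga_bar a * ga_bar b.
Proof.
have bar_qpowM (g : G) (c : grpalg R G) :
      ga_bar (qpow R g * c) = qpow R (- g) * ga_bar c.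
  rewrite {1}(grpalgE c) mulr_sumr ga_bar_sum [ga_bar c]/ga_bar mulr_sumr.
  apply: eq_bigr => h _; rewrite mulrC -ga_scaleAl ga_barZ -qpowD ga_bar_qpow.
  by rewrite [RHS]mulrC -ga_scaleAl -qpowD opprD.
rewrite {1}(grpalgE a) mulr_suml ga_bar_sum [ga_bar a]/ga_bar mulr_suml.
by apply: eq_bigr => g _; rewrite -!ga_scaleAl ga_barZ bar_qpowM.
Qed.

Lemma ga_bar1 : ga_bar (1 : grpalg R G) = 1.
Proof. by rewrite -(@qpow0 R G) ga_bar_qpow oppr0. Qed.

Lemma ga_barX a n : ga_bar (a ^+ n) = ga_bar a ^+ n.
Proof. by elim: n => [|n IH]; rewrite ?ga_bar1 // !exprS ga_barM IH. Qed.

End GroupAlgebraBar.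

Lemma ga_neg_bar (R : comNzRingType) (G : porderZmodType) (a : grpalg R G) :
  ordered_group G -> ga_pos a -> ga_neg (ga_bar a).
Proof.
move=> hG pos_a g; rewrite -mcoeff_neq0 mcoeff_ga_bar mcoeff_neq0 => /pos_a.
rewrite !Order.POrderTheory.lt_neqAle eq_sym oppr_eq0 => /andP[-> /=].
by move=> /(og_add hG g); rewrite add0r addNr.
Qed.

(** * Sums with finite support *)

(** The support of the summand is the same on both sides. If it is infinite,
    both sums take the default value 0. *)
Lemma injective_additive_fsbig (M N : zmodType) (f : M -> N)
    (I : choiceType) (X : set I) (F : I -> M) :
  {morph f : x y / x + y} -> injective f ->
  f (\sum_(i \in X) F i) = \sum_(i \in X) f (F i).
Proof.
move=> fD inj_f; have f0 : f 0 = 0 by apply: (addrI (f 0)); rewrite -fD !addr0.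
rewrite /finite_support.
have -> : ((fun i => f (F i)) @^-1` [set~ 0] = F @^-1` [set~ 0])%classic.
  apply/seteqP; split=> i /= Fi Fi0; apply: Fi; first by rewrite Fi0.
  by apply: inj_f; rewrite f0.
exact: (big_morph f fD f0).
Qed.

(** * Parity of the length in a Coxeter group *)

Section CoxeterSign.
Variables (W : groupType) (S : set W).
Hypothesis hS : coxeter_system S.
Local Notation len := (len S).

Lemma wprod_cat (u v : seq W) : wprod (u ++ v) = (wprod u * wprod v)%g.
Proof. by rewrite /wprod big_cat. Qed.

(** Each relator [(st)^m] has even length; this is what makes the sign character
    well defined. *)
Lemma cox_eqv_odd m (u v : seq W) :
  cox_eqv S m u v -> odd (size u) = odd (size v).
Proof.
elim=> {u v} [u v s t _ _|//|u v _ //|u v w _ -> _ ->//].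
by rewrite !size_cat !oddD size_flatten /shape map_nseq sumn_nseq oddM.
Qed.

Lemma len_word w : exists u, [/\ word_in S u, wprod u = w & size u = len w].
Proof.
have [m [_ gen _]] := hS; rewrite /len; case: pselect => [ex|[]].
  by case: ex_minnP => n /asboolP.
by have [u uS <-] := gen w; exists (size u); apply/asboolP; exists u.
Qed.

Lemma len_wprod_le u : word_in S u -> (len (wprod u) <= size u)%N.
Proof.
move=> uS; rewrite /len; case: pselect => [ex|//].
by case: ex_minnP => n _; apply; apply/asboolP; exists u.
Qed.

Lemma odd_len_wprod u : word_in S u -> odd (len (wprod u)) = odd (size u).
Proof.
move=> uS; have [v [vS eq_v <-]] := len_word (wprod u).
have [m [_ _ pres]] := hS.
exact: cox_eqv_odd (proj1 (pres v u vS uS) eq_v).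
Qed.

Lemma len1 : len 1 = 0%N.
Proof.
have := @len_wprod_le [::] (fun _ => ltac:(by rewrite in_nil)).
by rewrite /wprod big_nil leqn0 => /eqP.
Qed.

Lemma gen_involutive s : S s -> (s * s = 1)%g.
Proof.
move=> Ss; have [m [[m1 _ _] _ pres]] := hS.
have /pres : word_in S [:: s; s] by move=> x; rewrite !inE orbb => /eqP->.
move/(_ [::]) => [] // _; rewrite /wprod !big_cons !big_nil mulg1; apply.
by have := @cox_eqv_rel _ _ m [::] [::] s s Ss Ss; rewrite m1.
Qed.

Lemma odd_lenM s w : S s -> odd (len (s * w)%g) = ~~ odd (len w).
Proof.
move=> Ss; have [u [uS <- <-]] := len_word w.
have -> : (s * wprod u)%g = wprod (s :: u) by rewrite /wprod big_cons.
rewrite odd_len_wprod //= => x; rewrite inE => /predU1P[->//|]; exact: uS.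
Qed.

Lemma len_genM_le s w : S s -> (len (s * w)%g <= (len w).+1)%N.
Proof.
move=> Ss; have [u [uS <- <-]] := len_word w.
have -> : (s * wprod u)%g = wprod (s :: u) by rewrite /wprod big_cons.
by apply: len_wprod_le => x; rewrite inE => /predU1P[->//|]; exact: uS.
Qed.

(** A generator is not the identity, as the two have different signs. *)
Lemma len_gen s : S s -> len s = 1%N.
Proof.
move=> Ss; have := odd_lenM 1%g Ss; have := len_genM_le 1%g Ss.
by rewrite mulg1 len1; case: (len s) => [|[]].
Qed.

Lemma odd_lenV w : odd (len w^-1%g) = odd (len w).
Proof.
have [u [uS <- _]] := len_word w.
have -> : (wprod u)^-1%g = wprod (rev u).
  elim: u uS => [|s u IH] uS; first by rewrite /wprod /= big_nil invg1.
  have /gen_involutive ss : S s by apply: uS; rewrite mem_head.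
  rewrite rev_cons -cats1 wprod_cat -IH; last first.
    by move=> x xu; apply: uS; rewrite inE xu orbT.
  rewrite /wprod big_cons big_seq1 invgM; congr (_ * _)%g.
  by rewrite -[LHS]mulg1 -ss mulKg.
by rewrite !odd_len_wprod ?size_rev // => x; rewrite mem_rev; apply: uS.
Qed.

Lemma len_genM s w : S s -> (len (s * w)%g < len w)%N ->
  len w = (len (s * w)%g).+1.
Proof.
move=> Ss lt_sw; apply/eqP; rewrite eqn_leq lt_sw andbT.
have := len_genM_le (s * w)%g Ss.
by rewrite mulgA gen_involutive // mul1g.
Qed.

Lemma len_genM_gtVlt s w : S s ->
  (len w < len (s * w)%g)%N \/ (len (s * w)%g < len w)%N.
Proof.
move=> Ss; case: (ltngtP (len w) (len (s * w)%g)) => [lt|lt|eq_len].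
- by left.
- by right.
by have := odd_lenM w Ss; rewrite -eq_len; case: odd.
Qed.

Lemma gen_descent w : w <> 1%g -> exists2 s, S s & (len (s * w)%g < len w)%N.
Proof.
have [[|s u] [uS <- size_u]] := len_word w; first by rewrite /wprod big_nil.
have Ss : S s by apply: uS; rewrite mem_head.
move=> _; exists s => //; rewrite -size_u /wprod big_cons mulgA.
rewrite gen_involutive // mul1g ltnS len_wprod_le // => x xu.
by apply: uS; rewrite inE xu orbT.
Qed.

Lemma len_ind (Q : W -> Prop) : Q 1%g ->
  (forall s w, S s -> (len w < len (s * w)%g)%N -> Q w -> Q (s * w)%g) ->
  forall w, Q w.
Proof.
move=> Q1 QM w; have [n] := ubnP (len w); elim: n w => // n IH w lt_n.
have [->//|/gen_descent[s Ss lt_sw]] := pselect (w = 1%g).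
have ww : (s * (s * w))%g = w by rewrite mulgA gen_involutive // mul1g.
rewrite -ww; apply: QM => //; rewrite ?ww //.
exact: IH (leq_trans lt_sw lt_n).
Qed.

End CoxeterSign.

(** * Scalars of the group algebra acting on a module *)

Section ScalarAction.
Variables (R : comNzRingType) (G : porderZmodType) (H : algType (grpalg R G)).
Variable M : lmodType H.
Implicit Types (a c : grpalg R G) (x y : M) (h : H).

Lemma ascaleDl a c x : ascale (a + c) x = ascale a x + ascale c x.
Proof. by rewrite /ascale !scalerDl. Qed.

Lemma ascaleDr a x y : ascale a (x + y) = ascale a x + ascale a y.
Proof. exact: scalerDr. Qed.

Lemma ascaleNl a x : ascale (- a) x = - ascale a x.
Proof. by rewrite /ascale !scaleNr. Qed.

Lemma ascaleNr a x : ascale a (- x) = - ascale a x.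
Proof. exact: scalerN. Qed.

Lemma ascale1 x : ascale 1 x = x.
Proof. by rewrite /ascale !scale1r. Qed.

Lemma ascale0 x : ascale 0 x = 0.
Proof. by rewrite /ascale !scale0r. Qed.

Lemma ascaleA a c x : ascale a (ascale c x) = ascale (a * c) x.
Proof. by rewrite /ascale scalerA -scalerAl mul1r scalerA. Qed.

Lemma ascaleCA a c x : ascale a (ascale c x) = ascale c (ascale a x).
Proof. by rewrite !ascaleA mulrC. Qed.

Lemma scale_ascale h a x : h *: ascale a x = ascale a (h *: x).
Proof. by rewrite /ascale !scalerA -scalerAl -scalerAr mulr1 mul1r. Qed.

Lemma scale_ascalel h a x : (a *: h) *: x = ascale a (h *: x).
Proof. by rewrite /ascale scalerA -scalerAl mul1r. Qed.

Lemma ascale_suml I (u : seq I) (P : pred I) (F : I -> grpalg R G) x :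
  ascale (\sum_(i <- u | P i) F i) x = \sum_(i <- u | P i) ascale (F i) x.
Proof.
apply: (big_morph (fun a => ascale a x)) => [a c|].
  exact: ascaleDl.
exact: ascale0.
Qed.

End ScalarAction.

(** * Linear extension from a basis *)

Section BasisExtension.
Variables (R : comNzRingType) (G : porderZmodType) (H : algType (grpalg R G)).
Variables (I : eqType) (E : set I).
Implicit Types (M N : lmodType H) (l : seq (grpalg R G * I)).

(** The same index may occur several times in [l]: formal combinations can then
    be added by concatenation. *)
Definition lincomb M (b : I -> M) l : M :=
  \sum_(p <- l) ascale p.1 (b p.2).

Definition supported l := forall p, p \in l -> E p.2.

Lemma lincomb_cat M (b : I -> M) l1 l2 :
  lincomb b (l1 ++ l2) = lincomb b l1 + lincomb b l2.
Proof. by rewrite /lincomb big_cat. Qed.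

Lemma lincomb_scale M (b : I -> M) a l :
  lincomb b [seq (a * p.1, p.2) | p <- l] = ascale a (lincomb b l).
Proof.
rewrite /lincomb big_map [RHS]scaler_sumr; apply: eq_bigr => p _ /=.
by rewrite -[RHS]/(ascale _ (ascale _ _)) ascaleA.
Qed.

Lemma supported_cat l1 l2 :
  supported l1 -> supported l2 -> supported (l1 ++ l2).
Proof. by move=> l1E l2E p; rewrite mem_cat => /orP[/l1E|/l2E]. Qed.

Lemma supported_scale a l :
  supported l -> supported [seq (a * p.1, p.2) | p <- l].
Proof. by move=> lE p /mapP[p' /lE p'E ->]. Qed.

Lemma lincomb_collect M (b : I -> M) l :
  lincomb b l = \sum_(i <- undup [seq p.2 | p <- l])
    ascale (\sum_(p <- l | p.2 == i) p.1) (b i).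
Proof.
under eq_bigr => i _ do rewrite ascale_suml big_mkcond.
rewrite exchange_big /lincomb !big_seq; apply: eq_bigr => p lp.
rewrite (bigD1_seq p.2) ?undup_uniq ?mem_undup ?map_f //= eqxx.
by rewrite big1 ?addr0 // => i; rewrite eq_sym => /negbTE->.
Qed.

(** Freeness only speaks of combinations with distinct indices, hence the
    collection of the terms of equal index. This is the statement that the
    linear extension is well defined. *)
Lemma basis_lincomb_eq0 M N (b : I -> M) (n : I -> N) l :
  is_basis (@ascale R G H M) E b -> supported l ->
  lincomb b l = 0 -> lincomb n l = 0.
Proof.
move=> [_ free_b] lE; rewrite !lincomb_collect => /free_b c0.
rewrite big_seq big1 // => i li; rewrite c0 ?ascale0 ?undup_uniq // => j.
by rewrite mem_undup => /mapP[p /lE ? ->].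
Qed.

Lemma basis_extension M N (b : I -> M) (n : I -> N) :
  is_basis (@ascale R G H M) E b ->
  exists f : M -> N, [/\ {morph f : x y / x + y},
    forall a x, f (ascale a x) = ascale a (f x)
    & forall i, E i -> f (b i) = n i].
Proof.
move=> basis_b.
have span x : exists l, supported l /\ x = lincomb b l.
  have [u [c [uE ->]]] := basis_b.1 x; exists [seq (c i, i) | i <- u].
  by split=> [p /mapP[i /uE ? ->] //|]; rewrite /lincomb big_map.
have [coords coordsP] := choice span.
pose f x := lincomb n (coords x).
have f_lincomb l : supported l -> f (lincomb b l) = lincomb n l.
  move=> lE; have [cE eq_c] := coordsP (lincomb b l).
  apply/eqP; rewrite -subr_eq0 -[lincomb n l]ascale1 -ascaleNl.
  rewrite -lincomb_scale -lincomb_cat; apply/eqP.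
  apply: (basis_lincomb_eq0 _ basis_b).
    exact: supported_cat cE (supported_scale lE).
  by rewrite lincomb_cat lincomb_scale -eq_c ascaleNl ascale1 subrr.
exists f; split=> [x y|a x|i Ei].
- have [xE eq_x] := coordsP x; have [yE eq_y] := coordsP y.
  rewrite {1}eq_x {1}eq_y -lincomb_cat f_lincomb ?lincomb_cat //.
  exact: supported_cat.
- have [xE eq_x] := coordsP x.
  rewrite {1}eq_x -lincomb_scale f_lincomb ?lincomb_scale //.
  exact: supported_scale.
have -> : b i = lincomb b [:: (1, i)] by rewrite /lincomb big_seq1 ascale1.
rewrite f_lincomb /lincomb ?big_seq1 ?ascale1 // => p.
by rewrite inE => /eqP->.
Qed.

End BasisExtension.

(** * The sign character *)

Section Sign.
Variables (R : comNzRingType) (G : porderZmodType).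
Variables (W : groupType) (S : set W).
Hypothesis hS : coxeter_system S.
Local Notation eps := (eps R G S).

Lemma eps1 : eps 1%g = 1.
Proof. by rewrite /Defs.eps len1. Qed.

Lemma eps_genM s w : S s -> eps (s * w)%g = - eps w.
Proof.
by move=> Ss; rewrite /Defs.eps -signr_odd odd_lenM // signrN signr_odd.
Qed.

Lemma eps_gen s : S s -> eps s = -1.
Proof. by move=> Ss; rewrite /Defs.eps len_gen // expr1. Qed.

Lemma epsV w : eps w^-1%g = eps w.
Proof. by rewrite /Defs.eps -signr_odd odd_lenV // signr_odd. Qed.

Lemma eps_sqr w : eps w * eps w = 1.
Proof. by rewrite -expr2 sqrr_sign. Qed.

Lemma ga_bar_eps w : ga_bar (eps w) = eps w.
Proof. by rewrite /Defs.eps ga_barX ga_barN ga_bar1. Qed.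

End Sign.

(** * The Hecke algebra and the involution Phi *)

Section HeckeAlgebra.
Variables (W : groupType) (S : set W) (hS : coxeter_system S).
Variables (R : comNzRingType) (G : porderZmodType) (L : W -> G).
Variables (H : algType (grpalg R G)) (T : W -> H).
Hypothesis hT : hecke_algebra S L T.

(** The Hecke algebra is generated by the [T s]. Writing [T w] as a product
    along a reduced word leaves a last factor [T 1], not known to be the unit:
    if there is a generator [s], then [T 1] is obtained from the quadratic
    relation for [T s]; otherwise [W] is trivial, the algebra is free of rank
    one, and [T 1] is a scalar. *)
Lemma hecke_ind (Q : H -> Prop) :
  Q 1 -> (forall h k, Q h -> Q k -> Q (h + k)) ->
  (forall (a : grpalg R G) h, Q h -> Q (a *: h)) ->
  (forall s h, S s -> Q h -> Q (T s * h)) -> forall h, Q h.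
Proof.
move=> Q1 QD QZ QT.
have Q0 : Q 0 by rewrite -(scale0r 1); exact: QZ.
have Q_span (u : seq W) (c : W -> grpalg R G) :
    (forall w, w \in u -> Q (T w)) -> Q (\sum_(w <- u) c w *: T w).
  elim: u => [|w u IH] QTu; first by rewrite big_nil.
  rewrite big_cons; apply: QD; first by apply/QZ/QTu; rewrite mem_head.
  by apply: IH => v uv; apply: QTu; rewrite inE uv orbT.
have QT1 : Q (T 1%g).
  have [[s Ss]|S0] := pselect (exists s, S s).
    have lt_s : (len S (s * s)%g < len S s)%N.
      by rewrite (gen_involutive hS Ss) // len1 (len_gen hS).
    have QTs : Q (T s) by rewrite -(mulr1 (T s)); apply: QT.
    have -> : T 1%g = T s * T s + (- (qpow R (L s) - qpow R (- L s))) *: T s.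
      rewrite (hecke_down hT Ss lt_s) (gen_involutive hS Ss).
      by rewrite -addrA -scalerDl subrr scale0r addr0.
    by apply: QD; [apply: QT | apply: QZ].
  (* Without generators W is trivial; from 1 = a T_1 and T_1 T_1 = c T_1 follows
     T_1 = c (a T_1) = c. *)
  have W1 (w : W) : w = 1%g.
    have [//|/(gen_descent hS) [s Ss]] := pselect (w = 1%g).
    by case: S0; exists s.
  have span1 h : exists c : grpalg R G, h = c *: T 1%g.
    have [u [c [_ ->]]] := (hecke_basis hT).1 h.
    exists (\sum_(w <- u) c w); rewrite scaler_suml.
    by apply: eq_bigr => w _; rewrite (W1 w).
  have [a eq1] := span1 1; have [c eqTT] := span1 (T 1%g * T 1%g).
  rewrite -(mul1r (T 1%g)) {1}eq1 -scalerAl eqTT scalerA mulrC -scalerA -eq1.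
  exact: QZ.
have QTw w : Q (T w).
  elim/(len_ind hS): w => // s w Ss lt_sw Qw.
  by rewrite -(hecke_up hT Ss lt_sw); apply: QT.
by move=> h; have [u [c [_ ->]]] := (hecke_basis hT).1 h; apply: Q_span.
Qed.

Variables (bar : H -> H) (hbar : hecke_bar T bar).
Variables (Phi : {lrmorphism H -> H}) (hPhi : hecke_Phi S T bar Phi).

Lemma hecke_span_ind (Q : H -> Prop) :
  Q 0 -> (forall h k, Q h -> Q k -> Q (h + k)) ->
  (forall (a : grpalg R G) w, Q (a *: T w)) -> forall h, Q h.
Proof.
move=> Q0 QD QT h; have [u [c [_ ->]]] := (hecke_basis hT).1 h.
by elim/big_rec: _ => // w k _; apply: QD.
Qed.

Lemma hecke_bar0 : bar 0 = 0.
Proof. by apply: (addrI (bar 0)); rewrite -(hecke_bar_add hbar) !addr0. Qed.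

(** [bar (T w)] is the inverse of [T w^-1], so its image is the inverse of
    [Phi (T w^-1) = eps w *: bar (T w^-1)], and [bar (T w^-1)] is the inverse
    of [T w]. *)
Lemma Phi_barT w : Phi (bar (T w)) = eps R G S w *: T w.
Proof.
have [barTV _] := hecke_bar_T hbar w.
have PhiTV : Phi (bar (T w)) * (eps R G S w *: bar (T w^-1%g)) = 1.
  by rewrite -(epsV _ _ hS) -hPhi -rmorphM barTV rmorph1.
have inv : (eps R G S w *: bar (T w^-1%g)) * (eps R G S w *: T w) = 1.
  have [barT _] := hecke_bar_T hbar w^-1%g; rewrite invgK in barT.
  by rewrite -scalerAl -scalerAr scalerA eps_sqr scale1r.
by rewrite -[LHS]mulr1 -inv mulrA PhiTV mul1r.
Qed.

Lemma PhiK : involutive Phi.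
Proof.
apply: hecke_span_ind => [|h k Phih Phik|a w]; first by rewrite !rmorph0.
  by rewrite -[in RHS]Phih -[in RHS]Phik !rmorphD.
rewrite !linearZ /= hPhi linearZ /= Phi_barT; congr (_ *: _).
by rewrite scalerA eps_sqr scale1r.
Qed.

End HeckeAlgebra.

(** * Ideals of the left weak order *)

Section IdealCases.
Variables (W : groupType) (S J E : set W).
Hypotheses (hS : coxeter_system S) (hE : wgraph_ideal_set S J E).

Lemma ideal_descent s w : S s -> (len S (s * w)%g < len S w)%N ->
  E w -> E (s * w)%g.
Proof.
move=> Ss lt_sw Ew; apply: (wi_ideal hE Ew); exists s.
rewrite mulgA (gen_involutive hS Ss) mul1g; split=> //.
by rewrite (len_gen hS Ss) (len_genM hS Ss lt_sw).
Qed.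

Lemma ideal_ascent s w : S s -> (len S w < len S (s * w)%g)%N ->
  E (s * w)%g -> E w.
Proof.
move=> Ss lt_w Esw; have ww : (s * (s * w))%g = w.
  by rewrite mulgA (gen_involutive hS Ss) mul1g.
by rewrite -ww; apply: ideal_descent; rewrite ?ww.
Qed.

Lemma ideal_cases s w : S s -> E w ->
  [\/ E_minus S E s w, E_plus S E s w, E_0minus S J E s w | E_0plus S J E s w].
Proof.
move=> Ss Ew; have [lt_w|lt_sw] := len_genM_gtVlt hS w Ss; last first.
  by apply: Or41; split=> //; apply: ideal_descent.
have [Esw|nEsw] := pselect (E (s * w)%g); first by apply: Or42.
by have [Dsw|nDsw] := pselect (D S J (s * w)%g); [apply: Or44 | apply: Or43].
Qed.

End IdealCases.

(** * Uniqueness of the dual module *)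

Section DualModules.
Variables (W : groupType) (S : set W) (hS : coxeter_system S).
Variables (R : comNzRingType) (G : porderZmodType) (L : W -> G).
Variables (H : algType (grpalg R G)) (T : W -> H).
Hypothesis hT : hecke_algebra S L T.
Variables (bar : H -> H) (J E : set W) (hE : wgraph_ideal_set S J E).
Variable r : W -> W -> W -> grpalg R G.

Local Notation dual := (wgraph_dual_module S L J E T bar).

(** By induction along a reduced word, whose suffixes stay in the ideal, each
    basis vector is obtained from the base vector by applying generators. *)
Lemma dual_module_cyclic (M : lmodType H) (Gam : W -> M) barM :
  dual Gam r barM -> forall x, exists h : H, x = h *: Gam 1%g.
Proof.
move=> hM x.
have gen w : exists h : H, E w -> Gam w = h *: Gam 1%g.
  elim/(len_ind hS): w => [|s w Ss lt_w [h IH]].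
    by exists 1; rewrite scale1r.
  exists (T s * h) => Esw; have Ew := ideal_ascent hS hE Ss lt_w Esw.
  by rewrite -scalerA -(IH Ew) (wd_plus hM).
have [h hP] := choice gen.
have [u [c [uE ->]]] := (wd_basis hM).1 x.
exists (\sum_(w <- u) (c w)%:A * h w); rewrite scaler_suml !big_seq.
by apply: eq_bigr => w /uE Ew; rewrite -scalerA -hP.
Qed.

Variables (M N : lmodType H) (Gam : W -> M) (Del : W -> N).
Variables (barM : M -> M) (barN : N -> N).
Hypotheses (hM : dual Gam r barM) (hN : dual Del r barN).

(** The four rules express [T_s] on the basis by coefficients that do not
    depend on the module. *)
Lemma dual_module_iso : exists f : M -> N, [/\ bijective f,
  forall (h : H) x, f (h *: x) = h *: f x & f (Gam 1%g) = Del 1%g].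
Proof.
have [f [fD fZ fG]] := basis_extension Del (wd_basis hM).
have [g [gD gZ gD']] := basis_extension Gam (wd_basis hN).
have f0 : f 0 = 0 by apply: (addrI (f 0)); rewrite -fD !addr0.
have g0 : g 0 = 0 by apply: (addrI (g 0)); rewrite -gD !addr0.
have fK : cancel f g.
  move=> x; have [u [c [uE ->]]] := (wd_basis hM).1 x.
  rewrite (big_morph f fD f0) (big_morph g gD g0) !big_seq.
  by apply: eq_bigr => w /uE Ew; rewrite fZ gZ fG ?gD'.
have gK : cancel g f.
  move=> x; have [u [c [uE ->]]] := (wd_basis hN).1 x.
  rewrite (big_morph g gD g0) (big_morph f fD f0) !big_seq.
  by apply: eq_bigr => w /uE Ew; rewrite gZ fZ gD' ?fG.
have f_inj := can_inj fK.
have fT_basis s w : S s -> E w -> f (T s *: Gam w) = T s *: Del w.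
  move=> Ss Ew; have [Esw|Esw|Esw|Esw] := ideal_cases hS hE Ss Ew.
  - rewrite (wd_minus hM) // (wd_minus hN) // fD fZ !fG //.
    by case: Esw.
  - by rewrite (wd_plus hM) // (wd_plus hN) // fG //; case: Esw.
  - by rewrite (wd_0minus hM) // (wd_0minus hN) // fZ fG.
  rewrite (wd_0plus hM) // (wd_0plus hN) // fD fZ fG //; congr (_ + _).
  rewrite (injective_additive_fsbig _ _ fD f_inj); apply: eq_fsbigr => z.
  by rewrite inE => -[Ez _]; rewrite fZ fG.
exists f; split; [by exists g| |exact: fG (wi_one hE)].
elim/(hecke_ind hS hT) => [x|h k fh fk x|a h fh x|s h Ss fh x].
- by rewrite !scale1r.
- by rewrite !scalerDl fD fh fk.
- by rewrite !scale_ascalel fZ fh.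
rewrite -!scalerA -fh.
have [u [c [uE ->]]] := (wd_basis hM).1 (h *: x).
rewrite (big_morph f fD f0) !scaler_sumr (big_morph f fD f0) !big_seq.
apply: eq_bigr => w /uE Ew.
by rewrite scale_ascale !fZ fT_basis // fG // scale_ascale.
Qed.

End DualModules.

(** * Twisting a module by an endomorphism of the Hecke algebra *)

Section Twist.
Variables (R : comNzRingType) (G : porderZmodType) (H : algType (grpalg R G)).
Implicit Types (Phi : {lrmorphism H -> H}) (M : lmodType H).

(** The carrier is that of [M]; with [Phi] in its name the type can carry the
    twisted action as its canonical one. *)
Definition twist Phi M : Type := M.

Variables (Phi : {lrmorphism H -> H}) (M : lmodType H).
Local Notation MPhi := (twist Phi M).

HB.instance Definition _ := GRing.Zmodule.copy MPhi M.

Definition twist_scale (h : H) (x : MPhi) : MPhi := Phi h *: (x : M).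

Lemma twist_scaleA h k x :
  twist_scale h (twist_scale k x) = twist_scale (h * k) x.
Proof. by rewrite /twist_scale scalerA rmorphM. Qed.

Lemma twist_scale1 : left_id 1 twist_scale.
Proof. by move=> x; rewrite /twist_scale rmorph1 scale1r. Qed.

Lemma twist_scaleDr : right_distributive twist_scale +%R.
Proof. by move=> h x y; apply: scalerDr. Qed.

Lemma twist_scaleDl x : {morph twist_scale^~ x : h k / h + k}.
Proof. by move=> h k; rewrite /twist_scale rmorphD scalerDl. Qed.

HB.instance Definition _ := GRing.Zmodule_isLmodule.Build H MPhi
  twist_scaleA twist_scale1 twist_scaleDr twist_scaleDl.

Lemma twistE (h : H) (x : MPhi) : h *: x = Phi h *: (x : M).
Proof. by []. Qed.

Lemma twist_ascale (a : grpalg R G) (x : MPhi) : ascale a x = ascale a (x : M).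
Proof. by rewrite /ascale twistE linearZ rmorph1. Qed.

End Twist.

(** * Semilinear involutions *)

Section SemilinearInvolution.
Variables (R : comNzRingType) (G : porderZmodType) (H : algType (grpalg R G)).
Variables (bar : H -> H) (M : lmodType H) (x1 : M) (barM : M -> M).
Hypothesis hbarM : semilinear_involution bar x1 barM.

Lemma si0 : barM 0 = 0.
Proof. by apply: (addrI (barM 0)); rewrite -(si_add hbarM) !addr0. Qed.

Lemma siN (x : M) : barM (- x) = - barM x.
Proof. by apply: (addrI (barM x)); rewrite -(si_add hbarM) !subrr si0. Qed.

Lemma si_sum I (u : seq I) (F : I -> M) :
  barM (\sum_(i <- u) F i) = \sum_(i <- u) barM (F i).
Proof. exact: (big_morph barM (si_add hbarM) si0). Qed.

(** Applying the involution of [M] twice; this stands in for [bar] being an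
    involution of the Hecke algebra. *)
Lemma si_barK (h : H) (x : M) : bar (bar h) *: x = h *: x.
Proof.
by rewrite -{1}[x](si_invol hbarM) -!(si_hecke hbarM) (si_invol hbarM).
Qed.

End SemilinearInvolution.

(** * Existence of the dual module *)

Section TwistedModule.
Variables (W : groupType) (S : set W) (hS : coxeter_system S).
Variables (R : comNzRingType) (G : porderZmodType) (hG : ordered_group G).
Variables (L : W -> G) (H : algType (grpalg R G)) (T : W -> H).
Hypothesis hT : hecke_algebra S L T.
Variables (bar : H -> H) (hbar : hecke_bar T bar).
Variables (Phi : {lrmorphism H -> H}) (hPhi : hecke_Phi S T bar Phi).
Variables (J E : set W) (M : lmodType H) (Gam : W -> M).
Variables (r : W -> W -> W -> grpalg R G) (barM : M -> M).
Hypothesis hM : wgraph_module S L J E T bar Gam r barM.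

Local Notation eps := (eps R G S).
Let hbarM := wm_bar hM.

Definition twist_basis (w : W) : twist Phi M := ascale (eps w) (barM (Gam w)).

Lemma twist_basis1 : twist_basis 1%g = Gam 1%g.
Proof. by rewrite /twist_basis eps1 ascale1 (si_base hbarM). Qed.

Lemma barM_Gam w : barM (Gam w) = ascale (eps w) (twist_basis w).
Proof. by rewrite /twist_basis twist_ascale ascaleA eps_sqr ascale1. Qed.

Lemma twist_is_basis : is_basis (@ascale R G H (twist Phi M)) E twist_basis.
Proof.
split=> [x|u c uniq_u uE].
  have [u [c [uE eq_x]]] := (wm_basis hM).1 (barM x).
  exists u, (fun w => ga_bar (c w) * eps w); split=> //.
  rewrite -[x](si_invol hbarM) eq_x (si_sum hbarM); apply: eq_bigr => w _.
  by rewrite (si_scale hbarM) barM_Gam twist_ascale twist_ascale ascaleA.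
have eq_bar w : ascale (c w) (twist_basis w)
    = barM (ascale (ga_bar (c w) * eps w) (Gam w)).
  rewrite (si_scale hbarM) ga_barM ga_barK ga_bar_eps -ascaleA.
  by rewrite twist_ascale.
under eq_bigr => w _ do rewrite eq_bar.
move=> sum0 w uw; have sumM0 :
    \sum_(v <- u) ascale (ga_bar (c v) * eps v) (Gam v) = 0.
  by rewrite -[LHS](si_invol hbarM) (si_sum hbarM) sum0 (si0 hbarM).
have := (wm_basis hM).2 u _ uniq_u uE sumM0 w uw.
move/(congr1 (fun a => ga_bar (a * eps w))).
by rewrite -mulrA eps_sqr mulr1 ga_barK mul0r ga_bar0.
Qed.

Lemma twist_T s w : S s ->
  (T s : H) *: twist_basis w = - ascale (eps w) (barM (T s *: Gam w)).
Proof.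
move=> Ss; rewrite twistE hPhi (eps_gen _ _ hS Ss) scaleN1r scaleNr.
by rewrite scale_ascale (si_hecke hbarM).
Qed.

Lemma ga_bar_qdiff (g : G) :
  ga_bar (qpow R g - qpow R (- g)) = - (qpow R g - qpow R (- g)).
Proof. by rewrite ga_barD ga_barN !ga_bar_qpow opprK opprB addrC. Qed.

(** The compatibility with the action amounts to [bar (Phi h)] and
    [Phi (bar h)] acting alike on [M], which is semilinear in [h] and on
    [T w] reduces to [bar (bar (T w))] acting as [T w]. *)
Lemma twist_bar :
  semilinear_involution bar (twist_basis 1%g) (barM : twist Phi M -> twist Phi M).
Proof.
split=> [x y|a x|x||h x].
- exact: (si_add hbarM).
- by rewrite !twist_ascale (si_scale hbarM).
- exact: (si_invol hbarM).
- by rewrite twist_basis1 (si_base hbarM).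
rewrite !twistE (si_hecke hbarM); set y := barM x.
elim/(hecke_span_ind hT): h => [|h k eq_h eq_k|a w].
- by rewrite rmorph0 !(hecke_bar0 hbar) rmorph0.
- by rewrite rmorphD !(hecke_bar_add hbar) rmorphD !scalerDl eq_h eq_k.
rewrite linearZ /= !(hecke_bar_scale hbar) linearZ /= !scale_ascalel.
rewrite hPhi (hecke_bar_scale hbar) ga_bar_eps (Phi_barT hS hbar hPhi).
by rewrite !scale_ascalel (si_barK hbarM).
Qed.

(** Each rule is the image under the involution of [M] of the corresponding rule
    for [Gam]; the sign of [twist_T] is absorbed by [eps (s * w) = - eps w] or
    exchanges [q (L s)] with [- q (- L s)]. *)
Lemma twist_dual_module :
  wgraph_dual_module S L J E T bar twist_basis (r_dual S r)
    (barM : twist Phi M -> _).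
Proof.
split; [exact: twist_is_basis| | | | | |exact: twist_bar].
- move=> s w Ss Ew; rewrite twist_T // (wm_minus hM) // (si_add hbarM).
  rewrite (si_scale hbarM) ga_bar_qdiff ascaleNl ascaleDr ascaleNr opprB.
  rewrite twist_ascale ascaleCA addrC; congr (_ + _).
  by rewrite /twist_basis eps_genM // ascaleNl.
- move=> s w Ss Ew; rewrite twist_T // (wm_plus hM) //.
  by rewrite /twist_basis eps_genM // ascaleNl.
- move=> s w Ss Ew; rewrite twist_T // (wm_0minus hM) // (si_scale hbarM).
  rewrite ga_barN ga_bar_qpow opprK ascaleNl ascaleNr opprK ascaleCA.
  by rewrite twist_ascale.
- move=> s w Ss Ew; rewrite twist_T // (wm_0plus hM) // (si_add hbarM).
  rewrite (siN hbarM) (si_scale hbarM) ga_bar_qpow ascaleDr ascaleNr opprD opprK.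
  rewrite twist_ascale ascaleNl ascaleCA; congr (_ + _).
  (* The signs of z and w in r_dual come from undoing eps z in the basis vector
     of z and from the factor eps w of the basis vector of w. *)
  pose f (x : M) : twist Phi M := ascale (eps w) (barM x).
  have fD : {morph f : x y / x + y}.
    by move=> x y; rewrite /f (si_add hbarM) ascaleDr.
  have f_inj : injective f.
    apply: (can_inj (g := fun x => barM (ascale (eps w) (x : M)))) => x.
    by rewrite /f ascaleA eps_sqr ascale1 (si_invol hbarM).
  rewrite -[LHS]/(f _) (injective_additive_fsbig _ _ fD f_inj).
  apply: eq_fsbigr => z _; rewrite /f (si_scale hbarM) twist_ascale /twist_basis.
  rewrite !ascaleA; have -> // :
    r_dual S r s z w * eps z = eps w * ga_bar (r s z w).
  by rewrite /r_dual mulrC !mulrA eps_sqr mul1r.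
move=> s z w Ss Ew Ez lt_zw; have [a pos_a eq_r] := wm_r hM Ss Ew Ez lt_zw.
exists (eps z * eps w * ga_bar a); last first.
  by rewrite /r_dual eq_r ga_barM ga_bar_qpow mulrCA.
rewrite /Defs.eps -exprD -signr_odd; case: odd; rewrite ?mul1r ?mulN1r.
  by move=> g; rewrite msuppN; apply: ga_neg_bar.
exact: ga_neg_bar.
Qed.

End TwistedModule.

(** * The duality theorem *)

Theorem mainTheorem1
  (W : groupType) (S : set W) (hS : coxeter_system S)
  (G : porderZmodType) (hG : ordered_group G)
  (L : W -> G) (hL : weight_function S L) (hL0 : forall s, S s -> 0 <= L s)
  (K : realType) (P : {pred complex K}) (R : GRing.SubComNzRing.type P)
  (H : algType (grpalg R G)) (T : W -> H) (hT : hecke_algebra S L T)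
  (bar : H -> H) (hbar : hecke_bar T bar)
  (Phi : {lrmorphism H -> H}) (hPhi : hecke_Phi S T bar Phi)
  (J E : set W) (hE : wgraph_ideal_set S J E)
  (M : lmodType H) (Gam : W -> M) (r : W -> W -> W -> grpalg R G)
  (barM : M -> M) (hM : wgraph_module S L J E T bar Gam r barM) :
  (exists (M' : lmodType H) (Gam' : W -> M') (barM' : M' -> M'),
     wgraph_dual_module S L J E T bar Gam' (r_dual S r) barM')
  /\
  (forall (M' : lmodType H) (Gam' : W -> M') (barM' : M' -> M'),
     wgraph_dual_module S L J E T bar Gam' (r_dual S r) barM' ->
     exists eta : M -> M',
       [/\ unique (twisted_morphism Phi (Gam 1%g) (Gam' 1%g)) eta,
           forall m, eta (barM m) = barM' (eta m)
         & exists theta : M' -> M,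
             [/\ cancel eta theta, cancel theta eta
               & twisted_morphism Phi (Gam' 1%g) (Gam 1%g) theta]]).
Proof.
have hM2 := twist_dual_module hS hG hT hbar hPhi hM.
have base := twist_basis1 Phi hM.
split=> [|M' Gam' barM' hM'].
  by exists (twist Phi M), (twist_basis S Phi Gam barM), barM.
have [f [bij_f fH f1]] := dual_module_iso hS hT hE hM2 hM'.
rewrite base in f1.
have PhiK := PhiK hS hT hbar hPhi.
pose eta : M -> M' := f.
have etaH (h : H) (x : M) : eta (h *: x) = Phi h *: eta x.
  by rewrite /eta -fH twistE PhiK.
have gen (x : M) : exists h : H, x = h *: Gam 1%g.
  have [h eq_x] := dual_module_cyclic hS hE hM2 x.
  by exists (Phi h); rewrite [LHS]eq_x base.
exists eta; split.
- split=> // f' [f'1 f'H]; apply: funext => x; have [h ->] := gen x.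
  by rewrite etaH f'H f'1 /eta f1.
- move=> x; have [h eq_x] := dual_module_cyclic hS hE hM2 x.
  rewrite base in eq_x; rewrite eq_x /eta.
  rewrite (si_hecke (wd_bar hM2)) !fH (si_hecke (wd_bar hM')).
  by rewrite (si_base (wm_bar hM)) f1 (si_base (wd_bar hM')).
have [theta etaK thetaK] := bij_f.
exists theta; split=> //; split; first by rewrite -f1 etaK.
move=> h x; apply: (can_inj (f := eta) etaK).
by rewrite etaH PhiK -[eta _]/(f _) -[eta _]/(f _) !thetaK.
Qed.
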